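(* Let $\mathcal E_3=\{\mathbf 1[a^*(p_0,\pi)=a]\}_{p_0\in\mathcal P_0,a\in\mathcal A}$ and $\mathcal E_4=\{\mathbf 1[p^*(\pi)=p,\ a^*(p,\pi)=a]\}_{p\in\mathcal P_0,a\in\mathcal A}$ (events as functions of the forecast $\pi$), and $\mathcal E'=\mathcal E_3\cup\mathcal E_4$. Suppose the No Contextual Swap Regret assumption (parameter $\epsilon_{\mathrm{swap}}$), the Alignment assumption (parameters $M_1,M_2$) and the No Negative Cross-Swap-Regret assumption (parameter $\epsilon_{\mathrm{neg}}$) hold. Let $\sigma^\dagger$ be the mechanism that runs the forecasting algorithm of Noarov et al. for the events $\mathcal E'$ and uses the choice rule $p_t=p^*(\pi_t)$. Then $$\mathrm{PR}(\sigma^\dagger,\mathcal L,y_{1:T})\le\tilde O\left(|\mathcal Y|\sqrt{\frac{|\mathcal P_0||\mathcal A|}{T}}\right)+M_1(\epsilon_{\mathrm{swap}}+\epsilon_{\mathrm{neg}})+M_2 .$$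
   Context: Model. $\mathcal P$ is a policy space, $\mathcal A$ a finite action space, $\mathcal Y$ a finite state space (states identified with one-hot vectors), $\mathcal P_0\subseteq\mathcal P$ a finite set of benchmark policies. Agent utility $U(a,p,y)\in[-1,1]$, Principal utility $V(a,p,y)\in[-1,1]$. For $\pi\in\Delta(\mathcal Y)$, $U(a,p,\pi)=\mathbb E_{y\sim\pi}U(a,p,y)$, $V(a,p,\pi)=\mathbb E_{y\sim\pi}V(a,p,y)$. $a^*(p,\pi)$ is a fixed choice of element maximizing $V(\cdot,p,\pi)$ over $\arg\max_aU(a,p,\pi)$; $p^*(\pi)\in\arg\max_{p\in\mathcal P_0}V(a^*(p,\pi),p,\pi)$ (fixed tie-breaking). Interaction. A mechanism is a pair (forecasting algorithm $\mathcal F$, deterministic choice rule $\psi:\Delta(\mathcal Y)\to\mathcal P$). The state sequence $y_{1:T}$ is arbitrary. In round $t$: $\mathcal F$ (possibly randomized, based on the past but not on the Agent's actions) produces $\pi_t\in\Delta(\mathcal Y)$; the Principal announces $p_t=\psi(\pi_t)$ and recommendation $r_t=a^*(p_t,\pi_t)$; the Agent draws $a_t\sim\mathcal L_t(y_{1:t-1},a_{1:t-1},r_{1:t},p_{1:t})$, where $\mathcal L$ is his learning algorithm; then $y_t$ is revealed. For $p_0\in\mathcal P_0$, the constant mechanism $\sigma^{p_0}$ plays $p_0$ every round with recommendation $r_t^{p_0}=a^*(p_0,\pi_t)$ (same forecasts); $a^{p_0}_{1:T}$ are the actions $\mathcal L$ generates against it. $\mathrm{PR}(\psi,\pi_{1:T},\mathcal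 L,y_{1:T})=\max_{p_0\in\mathcal P_0}\mathbb E_{a_{1:T},a^{p_0}_{1:T}}\big[\frac1T\sum_t(V(a_t^{p_0},p_0,y_t)-V(a_t,p_t,y_t))\big]$, and $\mathrm{PR}((\mathcal F,\psi),\mathcal L,y_{1:T})=\mathbb E_{\pi_{1:T}}[\mathrm{PR}(\psi,\pi_{1:T},\mathcal L,y_{1:T})]$. No Contextual Swap Regret: $\mathbb E_{a_{1:T}}\big[\max_{h:\mathcal P\times\mathcal A\times\mathcal A\to\mathcal A}\frac1T\sum_t(U(h(p_t,r_t,a_t),p_t,y_t)-U(a_t,p_t,y_t))\big]\le\epsilon_{\mathrm{swap}}$, and for all $p_0\in\mathcal P_0$ the same holds with $(p_t,r_t,a_t)$ replaced by $(p_0,r_t^{p_0},a_t^{p_0})$. Alignment: for sequences of policies, recommendations and actions let $\mathrm{UGap}(y_{1:T},p_{1:T},r_{1:T},a_{1:T})=\frac1T\max_{h:\mathcal P_0\times\mathcal A\times\mathcal A\to\mathcal A}\min_{h':\mathcal P_0\times\mathcal A\to\mathcal A}\sum_t\big(U(h(p_t,r_t,a_t),p_t,y_t)-U(h'(p_t,r_t),p_t,y_t)\big)$. There exist $M_1=O(1)$, $M_2=o(1)$ such that, for realized sequences, under the proposed mechanism $\frac1T\sum_t(V(r_t,p_t,y_t)-V(a_t,p_t,y_t))\le M_1\,\mathrm{UGap}(y_{1:T},p_{1:T},r_{1:T},a_{1:T})+M_2$, and under any constant mechanism $\sigma^{p_0}$, $p_0\in\mathcal P_0$, $\frac1T\sum_t(V(a_t^{p_0},p_0,y_t)-V(r_t^{p_0},p_0,y_t))\le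 M_1\,\mathrm{UGap}(y_{1:T},(p_0,\dots,p_0),r^{p_0}_{1:T},a^{p_0}_{1:T})+M_2$. No Negative Cross-Swap-Regret: $\frac1T\mathbb E_{a_{1:T}}\big[\sum_tU(a_t,p_t,y_t)-\max_{h:\mathcal P_0\times\mathcal A\to\mathcal A}\sum_tU(h(p_t,r_t),p_t,y_t)\big]\le\epsilon_{\mathrm{neg}}$, and for all $p_0\in\mathcal P_0$ the same holds with $(p_t,r_t,a_t)$ replaced by $(p_0,r_t^{p_0},a_t^{p_0})$. Forecasting algorithm (known result of Noarov, Ramalingam, Roth, Xie 2023, which may be used). An event is a function $E:\Delta(\mathcal Y)\to\{0,1\}$; $\pi_{1:T}$ has bias $\alpha$ conditional on $\mathcal E$ if $\frac1T\|\sum_tE(\pi_t)(\pi_t-y_t)\|_1\le\alpha(E)$ for all $E\in\mathcal E$. For any collection $\mathcal E$ of (polynomial-time evaluable) events there is a forecasting algorithm, running in time polynomial in $|\mathcal Y|$ and $|\mathcal E|$ per round, such that for every $y_{1:T}$ the expected conditional bias satisfies $\mathbb E_{\pi_{1:T}}[\alpha(E)]\le O\Big(\frac{|\mathcal Y|\ln(|\mathcal Y||\mathcal E|T)}{T}+\frac{|\mathcal Y|\sqrt{\ln(|\mathcal Y||\mathcal E|T)\,|\{t:E(\pi_t)=1\}|}}{T}\Big)$. $\tilde O$ hides logarithmic factors in $T,|\mathcal Y|,|\mathcal P_0|,|\mathcal A|$.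
   Formalization: The bound is proved with 2(M1(ε_swap+ε_neg)+M2), since factor 1 is false (alignment is used for both mechanisms), and the forecasting guarantee is taken as E[max over events of (bias − rate)] ≤ 0, since its count of rounds is random and per-event bounds do not give the rate. *)

(* Defs.v *)
From HB Require Import structures.
From mathcomp Require Import all_boot all_order all_algebra finmap.
From mathcomp Require Import all_classical all_reals all_analysis.

Set Implicit Arguments.
Unset Strict Implicit.
Unset Printing Implicit Defensive.

Import Order.TTheory GRing.Theory Num.Theory.
Import numFieldNormedType.Exports.

Local Open Scope classical_set_scope.
Local Open Scope fset_scope.
Local Open Scope ring_scope.

(** Finite distributions, used for both the forecasts in Delta(Y) and the mixed
    actions of the Agent. *)
Record dist (R : realType) (I : finType) := Dist {
  dist_fun :> I -> R;
  dist_ge0 : forall i, 0 <= dist_fun i;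
  dist_sum1 : \sum_i dist_fun i = 1
}.

Definition mean (R : realType) (I : finType) (d : dist R I) (f : I -> R) : R :=
  \sum_i d i * f i.

Record principal_agent (R : realType) := PrincipalAgent {
  policy : choiceType;
  action : finType;
  state : finType;
  benchmark : {fset policy};
  U : action -> policy -> state -> R;
  V : action -> policy -> state -> R;
  U_bounded : forall a p y, -1 <= U a p y <= 1;
  V_bounded : forall a p y, -1 <= V a p y <= 1
}.

Definition forecast (R : realType) (G : principal_agent R) : Type :=
  dist R (state G).

Section Game.
Context (R : realType) (G : principal_agent R).

Definition Umean (a : action G) (p : policy G) (f : forecast G) : R :=
  mean f (U a p).
Definition Vmean (a : action G) (p : policy G) (f : forecast G) : R :=
  mean f (V a p).

Definition agent_optimal (a : action G) (p : policy G) (f : forecast G) : Prop :=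
  forall b, Umean b p f <= Umean a p f.

Definition is_response (astar : policy G -> forecast G -> action G) : Prop :=
  forall p f, agent_optimal (astar p f) p f /\
    forall a, agent_optimal a p f -> Vmean a p f <= Vmean (astar p f) p f.

Definition is_policy_choice (astar : policy G -> forecast G -> action G)
    (pstar : forecast G -> benchmark G) : Prop :=
  forall f (p0 : benchmark G),
    Vmean (astar (val p0) f) (val p0) f <=
    Vmean (astar (val (pstar f)) f) (val (pstar f)) f.

(** The arguments are, in this order, y_{1:t-1}, a_{1:t-1}, r_{1:t}, p_{1:t}. *)
Definition learner : Type :=
  seq (state G) -> seq (action G) -> seq (action G) -> seq (policy G) ->
  dist R (action G).

(** The choice rule of the constant mechanism playing [p0]. *)
Definition constant (p0 : benchmark G) : forecast G -> benchmark G :=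
  fun=> p0.

Section Horizon.
Context (T : nat).

Definition announced (S : Type) (psi : forecast G -> S)
  (f : T.-tuple (forecast G)) : T.-tuple S := map_tuple psi f.

Definition recommended (astar : policy G -> forecast G -> action G)
    (psi : forecast G -> policy G) (f : T.-tuple (forecast G)) :
  T.-tuple (action G) := map_tuple (fun x => astar (psi x) x) f.

(** Rounds are numbered from 0, so in round [t] the past has length [t]. *)
Definition play_prob (L : learner) (y : T.-tuple (state G))
    (p : T.-tuple (policy G)) (r a : T.-tuple (action G)) : R :=
  \prod_(t < T)
    L (take t y) (take t a) (take t.+1 r) (take t.+1 p) (tnth a t).

Definition play_mean (L : learner) (y : T.-tuple (state G))
    (p : T.-tuple (policy G)) (r : T.-tuple (action G))
    (X : T.-tuple (action G) -> R) : R :=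
  \sum_(a : T.-tuple (action G)) play_prob L y p r a * X a.

(** Here and below [sup] and [inf] range over finite nonempty sets of reals, also
    when [policy G] is infinite, so that they are a maximum and a minimum. *)
Definition swap_regret (y : T.-tuple (state G)) (p : T.-tuple (policy G))
    (r a : T.-tuple (action G)) : R :=
  sup (range (fun h : policy G * action G * action G -> action G =>
    T%:R^-1 * \sum_(t < T)
      (U (h (tnth p t, tnth r t, tnth a t)) (tnth p t) (tnth y t)
       - U (tnth a t) (tnth p t) (tnth y t)))).

Definition UGap (y : T.-tuple (state G)) (p : T.-tuple (benchmark G))
    (r a : T.-tuple (action G)) : R :=
  T%:R^-1 *
  sup (range (fun h : benchmark G * action G * action G -> action G =>
    inf (range (fun h' : benchmark G * action G -> action G =>
      \sum_(t < T)
        (U (h (tnth p t, tnth r t, tnth a t)) (val (tnth p t)) (tnth y t)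
         - U (h' (tnth p t, tnth r t)) (val (tnth p t)) (tnth y t)))))).

Definition neg_regret (y : T.-tuple (state G)) (p : T.-tuple (benchmark G))
    (r a : T.-tuple (action G)) : R :=
  \sum_(t < T) U (tnth a t) (val (tnth p t)) (tnth y t)
  - sup (range (fun h : benchmark G * action G -> action G =>
      \sum_(t < T)
        U (h (tnth p t, tnth r t)) (val (tnth p t)) (tnth y t))).

Section Transcript.
Context (astar : policy G -> forecast G -> action G) (L : learner).
Context (f : T.-tuple (forecast G)) (y : T.-tuple (state G)).

(** Law of, and expectation over, the actions played when [L] faces the choice
    rule [psi] with forecasts [f] and states [y]. *)
Definition action_prob (psi : forecast G -> policy G)
    (a : T.-tuple (action G)) : R :=
  play_prob L y (announced psi f) (recommended astar psi f) a.

Definition action_mean (psi : forecast G -> policy G)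
    (X : T.-tuple (action G) -> R) : R :=
  play_mean L y (announced psi f) (recommended astar psi f) X.

(** Regret for one sequence of forecasts; the two runs enter linearly, so
    taking them independent is immaterial. *)
Definition policy_regret (psi : forecast G -> policy G) : R :=
  sup (range (fun p0 : benchmark G =>
    action_mean psi (fun a =>
      action_mean (val \o constant p0) (fun a0 =>
        T%:R^-1 * \sum_(t < T)
          (V (tnth a0 t) (val p0) (tnth y t)
           - V (tnth a t) (psi (tnth f t)) (tnth y t)))))).

Definition swap_regret_le (eps : R) (psi : forecast G -> policy G) : Prop :=
  action_mean psi
    (fun a => swap_regret y (announced psi f) (recommended astar psi f) a)
  <= eps.

Definition neg_regret_le (eps : R) (psi : forecast G -> benchmark G) : Prop :=
  T%:R^-1 * action_mean (val \o psi)
    (fun a => neg_regret y (announced psi f)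
                (recommended astar (val \o psi) f) a)
  <= eps.

Definition no_contextual_swap_regret (eps : R)
    (pstar : forecast G -> benchmark G) : Prop :=
  swap_regret_le eps (val \o pstar) /\
  forall p0 : benchmark G, swap_regret_le eps (val \o constant p0).

Definition no_negative_cross_swap_regret (eps : R)
    (pstar : forecast G -> benchmark G) : Prop :=
  neg_regret_le eps pstar /\
  forall p0 : benchmark G, neg_regret_le eps (constant p0).

(** The inequalities are required of the action sequences that occur with
    positive probability. *)
Definition alignment (M1 M2 : R) (pstar : forecast G -> benchmark G) : Prop :=
  (forall a, 0 < action_prob (val \o pstar) a ->
    let p := announced pstar f in
    let r := recommended astar (val \o pstar) f in
    T%:R^-1 * \sum_(t < T)
      (V (tnth r t) (val (tnth p t)) (tnth y t)
       - V (tnth a t) (val (tnth p t)) (tnth y t))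
    <= M1 * UGap y p r a + M2) /\
  (forall (p0 : benchmark G) a, 0 < action_prob (val \o constant p0) a ->
    let r := recommended astar (val \o constant p0) f in
    T%:R^-1 * \sum_(t < T)
      (V (tnth a t) (val p0) (tnth y t) - V (tnth r t) (val p0) (tnth y t))
    <= M1 * UGap y (announced (constant p0) f) r a + M2).

End Transcript.
End Horizon.

Definition event : Type := forecast G -> bool.

Definition response_events (astar : policy G -> forecast G -> action G) :
    {fset event} :=
  [fset ((fun x => astar (val pa.1) x == pa.2) : event)
     | pa in [set: benchmark G * action G]%SET].

Definition choice_events (astar : policy G -> forecast G -> action G)
    (pstar : forecast G -> benchmark G) : {fset event} :=
  [fset ((fun x => (pstar x == pa.1) && (astar (val pa.1) x == pa.2)) : event)
     | pa in [set: benchmark G * action G]%SET].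

Section Bias.
Context (T : nat).

(** The state [y_t] enters as the one-hot vector [j |-> (j == y_t)]. *)
Definition bias (f : T.-tuple (forecast G)) (y : T.-tuple (state G))
    (E : event) : R :=
  T%:R^-1 * \sum_(j : state G)
    `| \sum_(t < T)
         (E (tnth f t))%:R * (tnth f t j - (j == tnth y t)%:R) |.

Definition occurrences (f : T.-tuple (forecast G)) (E : event) : nat :=
  #|[set t : 'I_T | E (tnth f t)]%SET|.

Definition bias_rate (C : R) (Es : {fset event}) (f : T.-tuple (forecast G))
    (E : event) : R :=
  let l := ln (#|{: state G}| * #|` Es| * T)%:R in
  C * (#|{: state G}|%:R * l / T%:R
       + #|{: state G}|%:R * Num.sqrt (l * (occurrences f E)%:R) / T%:R).

End Bias.

(** A randomized forecasting algorithm is a function of a random seed and of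
    the past states; past forecasts are themselves such functions, and the
    actions of the Agent are not an input. *)
Section Forecaster.
Context (d : measure_display) (Omega : measurableType d).
Context (mu : probability Omega R).

Definition forecaster : Type := Omega -> seq (state G) -> forecast G.

Definition forecasts (T : nat) (F : forecaster) (y : T.-tuple (state G))
    (w : Omega) : T.-tuple (forecast G) :=
  [tuple F w (take t y) | t < T].

Definition measurable_forecaster (F : forecaster) (Es : {fset event}) : Prop :=
  forall s : seq (state G),
    (forall j, measurable_fun [set: Omega] (fun w => F w s j)) /\
    (forall E : event, E \in Es -> measurable [set w | E (F w s)]).

(** Both the bias and the number of occurrences of an event depend on the
    realized forecasts, so the comparison takes place inside the expectation. It
    is simultaneous over the events of the collection, like the notion of
    conditional bias itself: [policy_regret] has its maximum over the benchmark
    policies inside the expectation over the forecasts, and a bound on the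
    expected bias of each event separately does not control that. *)
Definition unbiased_forecaster (T : nat) (C : R) (F : forecaster)
    (Es : {fset event}) : Prop :=
  measurable_forecaster F Es /\
  forall y : T.-tuple (state G),
    ('E_mu[fun w => sup [set (bias (forecasts F y w) y E
                              - bias_rate C Es (forecasts F y w) E)%R
                        | E in [set` Es]]]
     <= 0)%E.

Definition mechanism_regret (T : nat)
    (astar : policy G -> forecast G -> action G) (F : forecaster)
    (psi : forecast G -> policy G) (L : learner) (y : T.-tuple (state G)) :
    \bar R :=
  'E_mu[fun w => policy_regret astar L (forecasts F y w) y psi].

End Forecaster.
End Game.

(* Main.v *)
(** For one sequence of forecasts, the regret against [p0] splits into five
    parts: the gap between the Agent's actions and the recommendations, once
    under [p0] and once under the mechanism; the gap between realized and
    forecast payoffs of the recommendations, again once for each; and the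
    forecast payoff gap, which is nonpositive by the choice of [pstar].
    UGap is at most swap regret plus negative cross-swap-regret, so by alignment
    each of the first two is at most [M1 * (eps_swap + eps_neg) + M2] in mean.
    The next two are at most the sums of the biases over the response events
    of [p0] and over the choice events. Up to a multiple of the worst excess [S] of
    the biases over their rates, whose expectation is nonpositive, these sums
    are bounded by Cauchy-Schwarz, because each family of events partitions
    the rounds. If [T < |P0| |A|] the rates are too large for this, but the claim is
    then trivial: regret is at most 2, and alignment forces
    [-2 <= M1 * (eps_swap + eps_neg) + M2]. *)

Require Import Defs.
From mathcomp Require Import all_boot all_order all_algebra finmap.
From mathcomp Require Import all_classical all_reals all_analysis.
From mathcomp Require Import measurable_realfun.
From mathcomp Require Import ring lra.

Set Implicit Arguments.
Unset Strict Implicit.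
Unset Printing Implicit Defensive.

Import Order.TTheory GRing.Theory Num.Theory.

Local Open Scope classical_set_scope.
Local Open Scope fset_scope.
Local Open Scope ring_scope.

(** * Total mass of a product of kernels *)

(** Peel off the first coordinate [x]: given [x], the later factors are again kernels, namely
    [K t.+1 (x :: s)], so the induction runs over all [K]. *)
Lemma sum_prod_kernel1 (R : realType) (I : finType) (T : nat)
    (K : nat -> seq I -> dist R I) :
  \sum_(a : T.-tuple I) \prod_(t < T) K t (take t a) (tnth a t) = 1.
Proof.
elim: T K => [|T IHT] K.
  rewrite (big_pred1 [tuple]) ?big_ord0 // => a.
  by apply/esym/eqP; exact: tuple0.
rewrite (reindex (fun xa : I * T.-tuple I => cons_tuple xa.1 xa.2)) /=; last first.
  exists (fun a => (thead a, [tuple of behead a])) => [[x a] _|a _] /=.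
    by congr pair; apply/val_inj.
  by apply/val_inj; rewrite /= [in RHS](tuple_eta a).
rewrite -(pair_bigA _ (fun x a => \prod_(t < T.+1)
  K t (take t (cons_tuple x a)) (tnth (cons_tuple x a) t))) /=.
rewrite -[RHS](dist_sum1 (K 0 [::])); apply: eq_bigr => x _.
rewrite -[RHS]mulr1 -[X in _ = _ * X](IHT (fun t s => K t.+1 (x :: s))) big_distrr /=.
apply: eq_bigr => a _; rewrite big_ord_recl /=; congr (_ * _).
by apply: eq_bigr => t _; rewrite tnthS.
Qed.

(** * Play against a choice rule *)

Section Play.
Context (R : realType) (G : principal_agent R) (T : nat).
Context (astar : policy G -> forecast G -> action G) (L : learner G).
Context (f : T.-tuple (forecast G)) (y : T.-tuple (state G)).
Implicit Types (psi : forecast G -> policy G) (X Z : T.-tuple (action G) -> R).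

Lemma action_prob_ge0 psi a : 0 <= action_prob astar L f y psi a.
Proof. by apply: prodr_ge0 => t _; exact: dist_ge0. Qed.

Lemma sum_action_prob psi : \sum_a action_prob astar L f y psi a = 1.
Proof.
rewrite /action_prob /play_prob.
exact: (@sum_prod_kernel1 R (action G) T (fun t s => L (take t y) s
  (take t.+1 (recommended astar psi f)) (take t.+1 (announced psi f)))).
Qed.

Lemma action_mean_affine psi X (c e : R) :
  action_mean astar L f y psi (fun a => c * X a + e) =
  c * action_mean astar L f y psi X + e.
Proof.
rewrite /action_mean /play_mean -[e in RHS]mulr1 -[X in e * X](sum_action_prob psi).
rewrite !big_distrr -big_split /=; apply: eq_bigr => a _.
by rewrite /action_prob; ring.
Qed.

Lemma action_meanD psi X Z :
  action_mean astar L f y psi (fun a => X a + Z a) =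
  action_mean astar L f y psi X + action_mean astar L f y psi Z.
Proof.
by rewrite /action_mean /play_mean -big_split; apply: eq_bigr => a _; rewrite mulrDr.
Qed.

Lemma action_mean_cst psi (e : R) :
  action_mean astar L f y psi (fun=> e) = e.
Proof.
by rewrite /action_mean /play_mean -mulr_suml [X in X * _](sum_action_prob psi) mul1r.
Qed.

Lemma ler_action_mean psi X Z :
  (forall a, 0 < action_prob astar L f y psi a -> X a <= Z a) ->
  action_mean astar L f y psi X <= action_mean astar L f y psi Z.
Proof.
move=> XZ; apply: ler_sum => a _.
have := action_prob_ge0 psi a; rewrite le_eqVlt => /predU1P[p0|p_gt0].
  by rewrite -[play_prob _ _ _ _ _]p0 !mul0r.
exact: ler_wpM2l (ltW p_gt0) _ _ (XZ a p_gt0).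
Qed.

Lemma normr_V a p x : `|@V R G a p x| <= 1.
Proof. by rewrite ler_norml V_bounded. Qed.

Lemma ler_sum_ord (F : 'I_T -> R) (c : R) :
  (forall t, F t <= c) -> \sum_(t < T) F t <= T%:R * c.
Proof.
move=> Fc; apply: (@le_trans _ _ (\sum_(t < T) c)); first exact: ler_sum.
by rewrite sumr_const card_ord mulr_natl.
Qed.

(** Insert the utility of the played actions: [h] gains over them at most the swap regret, and their
    gain over the best [h'] is [neg_regret]. Minimizing a difference over [h'] amounts to
    subtracting the maximum over [h']. *)
Lemma UGap_le (p : T.-tuple (benchmark G)) (r a : T.-tuple (action G)) :
  (0 < T)%N ->
  UGap y p r a <= swap_regret y (map_tuple val p) r a + T%:R^-1 * neg_regret y p r a.
Proof.
move=> T_gt0; have T0 : 0 < T%:R :> R by rewrite ltr0n.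
pose S (h : 'I_T -> action G) := \sum_(t < T) U (h t) (val (tnth p t)) (tnth y t).
have ubS h : S h <= T%:R by rewrite -[leRHS]mulr1; apply: ler_sum_ord => t;
  have /andP[] := U_bounded (h t) (val (tnth p t)) (tnth y t).
have lbS h : - T%:R <= S h.
  rewrite lerNl -sumrN -[leRHS]mulr1; apply: ler_sum_ord => t.
  by rewrite lerNl; have /andP[] := U_bounded (h t) (val (tnth p t)) (tnth y t).
rewrite /UGap ler_pdivrMl // mulrDr mulrA mulfV ?gt_eqF // mul1r /neg_regret.
apply: ge_sup; first by exists (inf (range (fun h' : benchmark G * action G -> action G =>
   \sum_(t < T) (U (tnth a t) (val (tnth p t)) (tnth y t)
         - U (h' (tnth p t, tnth r t)) (val (tnth p t)) (tnth y t))))), (fun pra => pra.2).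
move=> _ [h _ <-].
(* Swap regret ranges over maps on all policies, so [h] is extended from the benchmark policies by
   keeping the played action elsewhere. *)
set g := fun pra : policy G * action G * action G =>
  if insub pra.1.1 is Some q then h (q, pra.1.2, pra.2) else pra.2.
have swapP : S (fun t => h (tnth p t, tnth r t, tnth a t)) - S (fun t => tnth a t) <=
    T%:R * swap_regret y (map_tuple val p) r a.
  rewrite -ler_pdivrMl //; apply: ub_le_sup; last first.
    exists g => //; rewrite /S -sumrB; congr (_ * _); apply: eq_bigr => t _.
    by rewrite tnth_map /g /= valK.
  exists 2 => _ [g' _ <-]; rewrite ler_pdivrMl //; apply: ler_sum_ord => t.
  have := U_bounded (g' (tnth (map_tuple val p) t, tnth r t, tnth a t))
    (tnth (map_tuple val p) t) (tnth y t).
  have := U_bounded (tnth a t) (tnth (map_tuple val p) t) (tnth y t).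
  by lra.
suff : sup (range (fun h' : benchmark G * action G -> action G =>
      \sum_(t < T) U (h' (tnth p t, tnth r t)) (val (tnth p t)) (tnth y t))) <=
    S (fun t => h (tnth p t, tnth r t, tnth a t)) -
    inf (range (fun h' : benchmark G * action G -> action G =>
      \sum_(t < T) (U (h (tnth p t, tnth r t, tnth a t)) (val (tnth p t)) (tnth y t)
         - U (h' (tnth p t, tnth r t)) (val (tnth p t)) (tnth y t)))).
  by move: swapP; rewrite /S; lra.
apply: ge_sup; first by exists (S (fun t => tnth r t)), (fun pr => pr.2).
move=> _ [h' _ <-]; rewrite lerBrDl -lerBrDr; apply: ge_inf.
  exists (- (T%:R + T%:R)) => _ [k _ <-]; rewrite sumrB.
  have := lbS (fun t => h (tnth p t, tnth r t, tnth a t)).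
  have := ubS (fun t => k (tnth p t, tnth r t)).
  by rewrite /S; lra.
by exists h'; rewrite // sumrB.
Qed.

(** Alignment holds for each sequence of positive probability, the two regret bounds in mean.
    Sequences of probability zero do not affect the mean, and [0 <= M1] preserves the bound on the
    mean of [UGap]. *)
Lemma alignment_mean_le (psi : forecast G -> benchmark G) X
    (eps_swap eps_neg M1 M2 : R) :
  (0 < T)%N -> 0 <= M1 ->
  swap_regret_le astar L f y eps_swap (val \o psi) ->
  neg_regret_le astar L f y eps_neg psi ->
  (forall a, 0 < action_prob astar L f y (val \o psi) a ->
    X a <= M1 * UGap y (announced psi f) (recommended astar (val \o psi) f) a + M2) ->
  action_mean astar L f y (val \o psi) X <= M1 * (eps_swap + eps_neg) + M2.
Proof.
move=> T_gt0 M1_ge0 swapP negP XP; apply: le_trans (ler_action_mean XP) _.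
rewrite action_mean_affine lerD2r ler_wpM2l //; apply: le_trans (lerD swapP negP).
rewrite -[_^-1 * _]addr0 -action_mean_affine -action_meanD.
apply: ler_action_mean => a _; rewrite addr0.
suff -> : announced (val \o psi) f = map_tuple val (announced psi f) by exact: UGap_le.
by apply/val_inj; rewrite /= -map_comp.
Qed.

End Play.

(** * Bias of the forecasts *)

Section Calibration.
Context (R : realType) (G : principal_agent R) (T : nat).
Context (f : T.-tuple (forecast G)) (y : T.-tuple (state G)).
Context (I : finType) (k : forecast G -> I) (E : I -> event G).
(** The events are the level sets of [k], so exactly one occurs in each round. Below, [k] is either
    the response to a fixed policy or the pair of chosen policy and response. *)
Hypothesis Ek : forall i x, E i x = (k x == i).

Lemma sum_event x (g : I -> R) : \sum_i (E i x)%:R * g i = g (k x).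
Proof.
rewrite (bigD1 (k x)) //= Ek eqxx mul1r big1 ?addr0 // => i i_neq.
by rewrite Ek eq_sym (negPf i_neq) mul0r.
Qed.

(** On the rounds of one event the payoff vector [v i] is fixed, so the error is the inner product
    of [v i] with the summed deviations of forecasts from states. Entries of size at most 1 leave
    the l1 norm, which is the bias. *)
Lemma calibration_error (v : I -> state G -> R) :
  (forall i j, `|v i j| <= 1) ->
  `|T%:R^-1 * \sum_(t < T)
     (mean (tnth f t) (v (k (tnth f t))) - v (k (tnth f t)) (tnth y t))|
  <= \sum_i bias f y (E i).
Proof.
move=> v_le1.
rewrite -mulr_sumr normrM ger0_norm ?invr_ge0 // ler_wpM2l ?invr_ge0 //.
have -> : \sum_(t < T)
     (mean (tnth f t) (v (k (tnth f t))) - v (k (tnth f t)) (tnth y t)) =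
  \sum_i \sum_j (\sum_(t < T)
     (E i (tnth f t))%:R * (tnth f t j - (j == tnth y t)%:R)) * v i j.
  (* The sum over rounds is moved outermost; in each round [sum_event] then accounts for the single
     event that occurs. *)
  under [RHS]eq_bigr => i _ do under eq_bigr => j _ do rewrite mulr_suml.
  under [RHS]eq_bigr => i _ do rewrite exchange_big /=.
  rewrite [RHS]exchange_big /=; apply: eq_bigr => t _.
  rewrite -[LHS](sum_event _ (fun i => mean (tnth f t) (v i) - v i (tnth y t))).
  apply: eq_bigr => i _.
  under [RHS]eq_bigr => j _ do rewrite -mulrA.
  rewrite -mulr_sumr; congr (_ * _).
  under [RHS]eq_bigr => j _ do rewrite mulrBl.
  rewrite sumrB; congr (_ - _).
  rewrite (bigD1 (tnth y t)) //= eqxx mul1r big1 ?addr0 // => j j_neq.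
  by rewrite (negPf j_neq) mul0r.
apply: le_trans (ler_norm_sum _ _ _) _; apply: ler_sum => i _.
apply: le_trans (ler_norm_sum _ _ _) _; apply: ler_sum => j _.
by rewrite normrM ler_piMr.
Qed.

Lemma sum_occurrences : (\sum_i occurrences f (E i) = T)%N.
Proof.
rewrite -[RHS]card_ord -sum1_card (partition_big (fun t => k (tnth f t)) predT) //=.
apply: eq_bigr => i _; rewrite /occurrences -sum1_card.
by apply: eq_bigl => t; rewrite inE Ek.
Qed.

Lemma sum_sqrt_le (x : I -> R) : (forall i, 0 <= x i) ->
  \sum_i Num.sqrt (x i) <= Num.sqrt (#|I|%:R * \sum_i x i).
Proof.
move=> x_ge0; have [I0|I_gt0] := posnP #|I|.
  by rewrite big_pred0 ?sqrtr_ge0 // => i; have /card0_eq := I0; move/(_ i).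
set s := \sum_i _; have s_ge0 : 0 <= s by apply: sumr_ge0 => i _; exact: sqrtr_ge0.
have I0 : 0 < #|I|%:R :> R by rewrite ltr0n.
rewrite -[s]ger0_norm // -sqrtr_sqr ler_wsqrtr //.
(* Cauchy-Schwarz, obtained from the nonnegative variance of the roots around their average
   [s / #|I|]. *)
have : 0 <= \sum_i (Num.sqrt (x i) - s / #|I|%:R) ^+ 2.
  by apply: sumr_ge0 => i _; exact: sqr_ge0.
have -> : \sum_i (Num.sqrt (x i) - s / #|I|%:R) ^+ 2 = \sum_i x i - s ^+ 2 / #|I|%:R.
  under eq_bigr => i _ do rewrite sqrrB sqr_sqrtr // -mulrnAr.
  rewrite big_split sumrB /= -mulr_suml -/s sumr_const -mulr_natl; field.
  by rewrite gt_eqF.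
by rewrite subr_ge0 ler_pdivrMr // mulrC.
Qed.

(** The first term of the rate is the same for all events. For the root terms, Cauchy-Schwarz
    applies with occurrences that add up to [T]. *)
Lemma sum_bias_rate_le (C : R) (Es : {fset event G})
    (l := ln (#|{: state G}| * #|` Es| * T)%:R : R) :
  0 <= C -> 0 <= l ->
  \sum_i bias_rate C Es f (E i) <=
  C * #|{: state G}|%:R * (l * (#|I|%:R / T%:R)
    + Num.sqrt l * Num.sqrt (#|I|%:R / T%:R)).
Proof.
move=> C_ge0 l_ge0; rewrite /bias_rate -/l -mulr_sumr -[leRHS]mulrA ler_wpM2l //.
rewrite big_split /= sumr_const mulrDr lerD //.
  by rewrite -mulr_natl le_eqVlt; apply/orP; left; apply/eqP; ring.
rewrite -mulr_suml -mulr_sumr -mulrA ler_wpM2l //.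
(* For [T = 0] both sides vanish, since the inverse of 0 is 0. *)
have [T0|T_gt0] := posnP T.
  have -> : T%:R^-1 = 0 :> R by rewrite T0 invr0.
  by rewrite !mulr0 sqrtr0 mulr0.
have T0 : 0 < T%:R :> R by rewrite ltr0n.
rewrite ler_pdivrMr //; apply: le_trans (sum_sqrt_le _) _.
  by move=> i; rewrite mulr_ge0.
rewrite -mulr_sumr -natr_sum sum_occurrences.
suff -> : #|I|%:R * (l * T%:R) = l * (#|I|%:R / T%:R) * T%:R ^+ 2 :> R.
  by rewrite sqrtrM ?mulr_ge0 ?divr_ge0 // sqrtr_sqr ger0_norm // sqrtrM.
by field; rewrite gt_eqF.
Qed.

Lemma sum_bias_le (S : R) (g : event G -> R) :
  (forall i, bias f y (E i) - g (E i) <= S) ->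
  \sum_i bias f y (E i) <= #|I|%:R * S + \sum_i g (E i).
Proof.
move=> biasP; rewrite mulr_natl -[#|I|]/#|[pred _ : I | true]| -sumr_const -big_split.
by apply: ler_sum => i _; rewrite -lerBlDr.
Qed.

End Calibration.

(** * Regret for one sequence of forecasts *)

Section PointwiseRegret.
Context (R : realType) (G : principal_agent R) (T : nat).
Context (astar : policy G -> forecast G -> action G) (L : learner G).
Context (pstar : forecast G -> benchmark G).
Context (f : T.-tuple (forecast G)) (y : T.-tuple (state G)).
Hypothesis T_gt0 : (0 < T)%N.

Definition payoff (psi : forecast G -> policy G) (a : T.-tuple (action G)) : R :=
  T%:R^-1 * \sum_(t < T) V (tnth a t) (psi (tnth f t)) (tnth y t).

Definition response_event (p : benchmark G) (a : action G) : event G :=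
  fun x => astar (val p) x == a.

Definition choice_event (pa : benchmark G * action G) : event G :=
  fun x => (pstar x == pa.1) && (astar (val pa.1) x == pa.2).

Lemma choice_eventE pa x : choice_event pa x = ((pstar x, astar (val (pstar x)) x) == pa).
Proof. by case: pa => p a; rewrite /choice_event xpair_eqE /=; case: eqP => //= ->. Qed.

Lemma normr_payoff_le1 psi a : `|payoff psi a| <= 1.
Proof.
rewrite /payoff normrM ger0_norm ?invr_ge0 // ler_pdivrMl ?ltr0n //.
by apply: le_trans (ler_norm_sum _ _ _) _; apply: ler_sum_ord => t; exact: normr_V.
Qed.

Lemma payoff_recommended psi :
  payoff psi (recommended astar psi f) = T%:R^-1 *
    \sum_(t < T) V (astar (psi (tnth f t)) (tnth f t)) (psi (tnth f t)) (tnth y t).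
Proof. by congr (_ * _); apply: eq_bigr => t _; rewrite tnth_map. Qed.

(** The two runs enter additively, so the nested mean separates into one mean per run. *)
Lemma policy_regretE psi :
  policy_regret astar L f y psi = sup (range (fun p0 : benchmark G =>
    action_mean astar L f y (val \o Defs.constant p0) (payoff (val \o Defs.constant p0))
    - action_mean astar L f y psi (payoff psi))).
Proof.
congr sup; congr image.
apply/funext => p0.
transitivity (action_mean astar L f y psi (fun a => -1 * payoff psi a +
    action_mean astar L f y (val \o Defs.constant p0) (payoff (val \o Defs.constant p0)))).
  congr action_mean; apply/funext => a.
  rewrite -[X in _ + X]mul1r addrC mulN1r -action_mean_affine.
  congr action_mean; apply/funext => a0.
  by rewrite sumrB mulrBr mul1r.
by rewrite action_mean_affine mulN1r addrC.
Qed.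

Lemma normr_action_mean_le psi (X : T.-tuple (action G) -> R) (c : R) :
  (forall a, `|X a| <= c) -> `|action_mean astar L f y psi X| <= c.
Proof.
move=> Xc; rewrite ler_norml -{1}(action_mean_cst astar L f y psi (- c)).
rewrite -[X in _ && (_ <= X)](action_mean_cst astar L f y psi c).
by apply/andP; split; apply: ler_action_mean => a _; have := Xc a; rewrite ler_norml => /andP[].
Qed.

Lemma normr_policy_regret_le2 psi : `|policy_regret astar L f y psi| <= 2.
Proof.
(* The policy chosen in round 0 shows that the supremum is over a nonempty set. *)
have q : benchmark G by exact: pstar (tnth f (Ordinal T_gt0)).
have pay psi' := normr_action_mean_le psi' (normr_payoff_le1 psi').
rewrite policy_regretE ler_norml; apply/andP; split.
  apply: (@le_trans _ _ (action_mean astar L f y (val \o Defs.constant q) (payoff (val \o Defs.constant q))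
    - action_mean astar L f y psi (payoff psi))).
    by have := pay psi; have := pay (val \o Defs.constant q); rewrite !ler_norml; lra.
  apply: ub_le_sup; last by exists q.
  exists 2 => _ [p _ <-].
  by have := pay psi; have := pay (val \o Defs.constant p); rewrite !ler_norml; lra.
apply: ge_sup; first by eexists; exists q.
move=> _ [p _ <-].
by have := pay psi; have := pay (val \o Defs.constant p); rewrite !ler_norml; lra.
Qed.

Context (eps_swap eps_neg M1 M2 : R).
Hypothesis M1_ge0 : 0 <= M1.
Hypothesis swapP : no_contextual_swap_regret astar L f y eps_swap pstar.
Hypothesis alignP : alignment astar L f y M1 M2 pstar.
Hypothesis negP : no_negative_cross_swap_regret astar L f y eps_neg pstar.
Let slack := M1 * (eps_swap + eps_neg) + M2.

(** The signs in the two halves of alignment differ: under the mechanism the actions must not fall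
    far below the recommendations, under a constant policy they must not rise far above them. *)
Lemma choice_payoff_gap :
  payoff (val \o pstar) (recommended astar (val \o pstar) f) -
  action_mean astar L f y (val \o pstar) (payoff (val \o pstar)) <= slack.
Proof.
rewrite addrC -mulN1r -action_mean_affine.
apply: alignment_mean_le => //; [exact: swapP.1 | exact: negP.1 |] => a a_gt0.
apply: le_trans (alignP.1 a a_gt0).
rewrite mulN1r addrC /payoff -mulrBr -sumrB le_eqVlt; apply/orP; left; apply/eqP.
by congr (_ * _); apply: eq_bigr => t _; rewrite !tnth_map.
Qed.

Lemma constant_payoff_gap p0 :
  action_mean astar L f y (val \o Defs.constant p0) (payoff (val \o Defs.constant p0)) -
  payoff (val \o Defs.constant p0) (recommended astar (val \o Defs.constant p0) f) <= slack.
Proof.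
rewrite -[X in X - _]mul1r -action_mean_affine.
apply: alignment_mean_le => //; [exact: swapP.2 | exact: negP.2 |] => a a_gt0.
apply: le_trans (alignP.2 p0 a a_gt0).
by rewrite mul1r /payoff -mulrBr -sumrB.
Qed.

(** The gap bounded by [slack] is a difference of two payoffs in [-1, 1]. This serves the case of
    few rounds, where regret is bounded only by 2. *)
Lemma slack_ge : -2 <= slack.
Proof.
apply: le_trans choice_payoff_gap.
have := normr_payoff_le1 (val \o pstar) (recommended astar (val \o pstar) f).
have := normr_action_mean_le (val \o pstar) (normr_payoff_le1 (val \o pstar)).
by rewrite !ler_norml; lra.
Qed.

Hypothesis pstarP : is_policy_choice astar pstar.

Lemma policy_regret_le_bias (D1 D2 : R) :
  (forall p0, \sum_a bias f y (response_event p0 a) <= D1) ->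
  \sum_pa bias f y (choice_event pa) <= D2 ->
  policy_regret astar L f y (val \o pstar) <= D1 + D2 + 2 * slack.
Proof.
move=> biasD1 biasD2; rewrite policy_regretE; apply: ge_sup.
  by eexists; exists (pstar (tnth f (Ordinal T_gt0))).
move=> _ [p0 _ <-].
have gap1 := constant_payoff_gap p0; have gap2 := choice_payoff_gap.
have fcst1 := @calibration_error R G T f y (action G) (fun x => astar (val p0) x)
  (response_event p0) (fun _ _ => erefl) (fun a => V a (val p0)) (fun a j => normr_V a _ j).
have fcst2 := @calibration_error R G T f y _ (fun x => (pstar x, astar (val (pstar x)) x))
  choice_event choice_eventE (fun pa => V pa.2 (val pa.1)) (fun pa j => normr_V pa.2 _ j).
have opt : T%:R^-1 * \sum_(t < T) mean (tnth f t) (V (astar (val p0) (tnth f t)) (val p0))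
    <= T%:R^-1 * \sum_(t < T) mean (tnth f t)
      (V (astar (val (pstar (tnth f t))) (tnth f t)) (val (pstar (tnth f t)))).
  by rewrite ler_wpM2l ?invr_ge0 //; apply: ler_sum => t _; exact: pstarP.
(* The chain runs from the actions under [p0] to its recommendations, their forecast payoff, that of
   [pstar], the realized recommendations and finally the actions; the first and last links cost
   [slack] each. *)
move: fcst1 fcst2 gap1 gap2 (biasD1 p0) biasD2 opt.
rewrite !payoff_recommended !sumrB !mulrBr !ler_norml /=.
lra.
Qed.

End PointwiseRegret.

(** * Measurability and expectation *)

Lemma ub_le_sup_fset (R : realType) (I : choiceType) (A : {fset I}) (g : I -> R) i :
  i \in A -> g i <= sup [set g j | j in [set` A]].
Proof.
move=> iA; apply: ub_le_sup; last by exists i.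
exists (\sum_(j <- A) `|g j|) => _ [j /= jA <-].
rewrite (big_rem j) //= (le_trans (ler_norm _)) // lerDl.
by apply: sumr_ge0 => k _; exact: normr_ge0.
Qed.

Lemma normr_sup_fset_le (R : realType) (I : choiceType) (A : {fset I}) (g : I -> R) (c : R) :
  0 <= c -> (forall i, `|g i| <= c) -> `|sup [set g j | j in [set` A]]| <= c.
Proof.
move=> c_ge0 gc; have [->|[i iA]] := fset_0Vmem A.
  (* The supremum of the empty set is 0 by default; here [0 <= c] is used. *)
  rewrite (_ : [set _ | _ in _] = set0) ?sup0 ?normr0 //.
  by apply/seteqP; split=> // x [i] /=; rewrite inE.
have gcE j : - c <= g j <= c by rewrite -ler_norml.
rewrite ler_norml; apply/andP; split.
  by apply: le_trans (ub_le_sup_fset g iA); have /andP[] := gcE i.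
apply: ge_sup; first by exists (g i), i.
by move=> _ [j _ <-]; have /andP[] := gcE j.
Qed.

Section Measurability.
Context (R : realType) (d : measure_display) (Omega : measurableType d).

(** The supremum of a nonempty family exceeds [c] exactly when some member does, so preimages of the
    generating rays []c, +oo[] are finite unions. *)
Lemma measurable_fun_sup_fset (I : choiceType) (A : {fset I}) (g : I -> Omega -> R) :
  (forall i, i \in A -> measurable_fun [set: Omega] (g i)) ->
  measurable_fun [set: Omega] (fun w => sup [set g i w | i in [set` A]]).
Proof.
move=> mg; have [A0|[i0 iA0]] := fset_0Vmem A.
  rewrite A0 (_ : (fun _ => _) = cst 0) //; apply/funext => w.
  rewrite (_ : [set _ | _ in _] = set0) ?sup0 //.
  by apply/seteqP; split=> // x [i] /=; rewrite inE.
move=> mD; apply: (measurability _ (RGenOInfty.measurableE R)) => //.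
move=> /= _ [_ [c ->] <-]; rewrite setTI.
rewrite [X in measurable X](_ : _ = (\bigcup_(i in [set` A]) (g i @^-1` `]c, +oo[))%classic); last first.
  apply/seteqP; split=> w /=.
    rewrite in_itv /= andbT => /sup_gt[]; first by exists (g i0 w), i0.
    by move=> _ [i iA <-] ltc; exists i; rewrite //= in_itv /= andbT.
  case=> i /= iA; rewrite !in_itv /= !andbT => /lt_le_trans; apply.
  exact: (ub_le_sup_fset (g ^~ w)).
apply: fin_bigcup_measurable => // i iA.
by rewrite -[X in measurable X]setTI; apply: mg => //; exact: measurable_itv.
Qed.

(** Every preimage under [X] is a union of fibres of [q], of which there are finitely many. *)
Lemma measurable_fun_finite_factor (I : finType) (q : Omega -> I) (X : Omega -> R) :
  (forall i, measurable (q @^-1` [set i])) ->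
  (forall w w', q w = q w' -> X w = X w') ->
  measurable_fun [set: Omega] X.
Proof.
move=> mq qX _ B mB; rewrite setTI.
rewrite (_ : X @^-1` B =
    (\bigcup_(i in [set i | exists2 w, q w = i & B (X w)]) (q @^-1` [set i]))%classic).
  by apply: fin_bigcup_measurable => // i _; exact: mq.
apply/seteqP; split=> w /= => [BXw|[i [w' <- BXw'] /= qw]].
  by exists (q w) => //; exists w.
by rewrite (qX w w' qw).
Qed.

Lemma bounded_Lfun1 (mu : probability Omega R) (X : Omega -> R) (B : R) :
  measurable_fun [set: Omega] X -> (forall w, `|X w| <= B) -> X \in Lfun mu 1.
Proof.
move=> mX XB; apply/Lfun1_integrable; apply: measurable_bounded_integrable => //.
  exact: le_lt_trans (probability_le1 mu measurableT) (ltry 1).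
by exists B; split; rewrite ?num_real // => M BM w _; exact: le_trans (XB w) (ltW BM).
Qed.

Lemma expectation_le_affine (mu : probability Omega R) (X S : Omega -> R) (c e B : R) :
  measurable_fun [set: Omega] X -> (forall w, `|X w| <= B) ->
  measurable_fun [set: Omega] S -> (forall w, `|S w| <= B) ->
  0 <= c -> ('E_mu[S] <= 0)%E ->
  {ae mu, forall w, X w <= c * S w + e} ->
  ('E_mu[X] <= e%:E)%E.
Proof.
move=> mX XB mS SB c_ge0 ES_le0 leXS.
have LX := bounded_Lfun1 mu mX XB; have LS := bounded_Lfun1 mu mS SB.
have Lcst r : cst r \in Lfun mu 1.
  by apply: (@bounded_Lfun1 _ _ `|r|) => // w; exact: lexx.
have mcS : measurable_fun [set: Omega] (c \o* S).
  exact: measurableT_comp (mulrr_measurable c) mS.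
have LcS : c \o* S \in Lfun mu 1.
  apply: (@bounded_Lfun1 _ _ (B * c)) => // w.
  by rewrite /= normrM (ger0_norm c_ge0) ler_wpM2r.
(* Adding [K] makes both sides nonnegative, as monotonicity of the expectation requires; it is
   cancelled at the end. *)
set K := B + B * c + `|e|.
have XK w : - B <= X w by have := XB w; rewrite ler_norml => /andP[].
have SK w : - B * c <= S w * c.
  by rewrite ler_wpM2r //; have := SB w; rewrite ler_norml => /andP[].
have Bc_ge0 (w : Omega) : 0 <= B * c by rewrite mulr_ge0 // (le_trans _ (SB w)).
have B_ge0 (w : Omega) : 0 <= B by rewrite (le_trans _ (SB w)).
have e_le : - `|e| <= e by rewrite lerNl -normrN ler_norm.
have e_ge0 : 0 <= `|e| by [].
have : ('E_mu[(X \+ cst K)%R] <= 'E_mu[(c \o* S \+ cst (e + K))%R])%E.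
  apply: expectation_le.
  - exact: measurable_funD.
  - exact: measurable_funD.
  - by move=> w; have {}Bc_ge0 := Bc_ge0 w; have {}B_ge0 := B_ge0 w; have := XK w; rewrite /= /K; lra.
  - by move=> w; have {}Bc_ge0 := Bc_ge0 w; have {}B_ge0 := B_ge0 w; have := SK w; rewrite /= /K; lra.
  - by apply: filterS leXS => w /=; move: {Bc_ge0 B_ge0} (X w) (S w) K => x s K; lra.
rewrite (expectationD LX (Lcst K)) (expectationD LcS (Lcst (e + K))).
rewrite !expectation_cst expectationZl // [(e + K)%:E]EFinD => EXle.
rewrite -(@leeD2rE _ K%:E _ _ isT); apply: (le_trans EXle).
rewrite -[leRHS]add0e leeD2r //.
by rewrite mule_ge0_le0 // lee_fin.
Qed.

End Measurability.

Lemma ln_nat_ge0 (R : realType) n : 0 <= ln n%:R :> R.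
Proof. by case: n => [|n]; [rewrite ln0 | apply: ln_ge0; rewrite ler1n]. Qed.

(** * Dependence on the random seed *)

Section EventBounds.
Context (R : realType) (G : principal_agent R) (T : nat).
Context (f : T.-tuple (forecast G)) (y : T.-tuple (state G)).
Hypothesis T_gt0 : (0 < T)%N.

Lemma dist_le1 (I : finType) (D : dist R I) i : D i <= 1.
Proof.
rewrite -(dist_sum1 D) (bigD1 i) //= lerDl.
by apply: sumr_ge0 => j _; exact: dist_ge0.
Qed.

Lemma normr_bias_le E : `|bias f y E| <= #|{: state G}|%:R.
Proof.
rewrite /bias normrM ger0_norm ?invr_ge0 // ler_pdivrMl ?ltr0n //.
apply: le_trans (ler_norm_sum _ _ _) _.
rewrite mulrC mulr_natl -[#|_|]/#|[pred _ : state G | true]| -sumr_const.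
apply: ler_sum => j _; rewrite normr_id; apply: le_trans (ler_norm_sum _ _ _) _.
rewrite -[leRHS]mulr1; apply: ler_sum_ord => t.
have := dist_ge0 (tnth f t) j; have := dist_le1 (tnth f t) j.
by rewrite ler_norml; case: (E _); case: (j == _) => /=; lra.
Qed.

Lemma normr_bias_rate_le (C : R) (Es : {fset event G}) E : 0 <= C ->
  `|bias_rate C Es f E| <=
  C * (#|{: state G}|%:R * ln (#|{: state G}| * #|` Es| * T)%:R / T%:R
    + #|{: state G}|%:R * Num.sqrt (ln (#|{: state G}| * #|` Es| * T)%:R * T%:R) / T%:R).
Proof.
move=> C_ge0; have l_ge0 := ln_nat_ge0 R (#|{: state G}| * #|` Es| * T).
rewrite /bias_rate ger0_norm ?mulr_ge0 ?addr_ge0 ?divr_ge0 ?mulr_ge0 ?sqrtr_ge0 //.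
rewrite ler_wpM2l // lerD2l ler_wpM2r ?invr_ge0 // ler_wpM2l // ler_wsqrtr //.
rewrite ler_wpM2l // ler_nat.
by rewrite /occurrences -[leqRHS]card_ord max_card.
Qed.

End EventBounds.

(** Forecasts enter the regret only through announced policies and recommendations, which take
    finitely many values. *)
Lemma policy_regret_ext (R : realType) (G : principal_agent R) (T : nat)
    (astar : policy G -> forecast G -> action G) (L : learner G)
    (pstar : forecast G -> benchmark G) (f f' : T.-tuple (forecast G)) y :
  (forall t, pstar (tnth f t) = pstar (tnth f' t)) ->
  (forall t (p : benchmark G),
    astar (val p) (tnth f t) = astar (val p) (tnth f' t)) ->
  policy_regret astar L f y (val \o pstar) = policy_regret astar L f' y (val \o pstar).
Proof.
move=> pE aE; rewrite !policy_regretE.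
suff meanE (psi : forecast G -> benchmark G) :
    (forall t, psi (tnth f t) = psi (tnth f' t)) ->
    action_mean astar L f y (val \o psi) (payoff f y (val \o psi)) =
    action_mean astar L f' y (val \o psi) (payoff f' y (val \o psi)).
  by rewrite (meanE pstar) //; congr sup; congr image; apply/funext => p0; rewrite meanE.
move=> psiE; rewrite /action_mean.
have -> : announced (val \o psi) f = announced (val \o psi) f'.
  by apply: eq_from_tnth => t; rewrite !tnth_map /= psiE.
have -> : recommended astar (val \o psi) f = recommended astar (val \o psi) f'.
  by apply: eq_from_tnth => t; rewrite !tnth_map /= psiE aE.
congr play_mean; apply/funext => a; congr (_ * _).
by apply: eq_bigr => t _; rewrite /= psiE.
Qed.

Section ForecastMeasurability.
Context (R : realType) (G : principal_agent R) (T : nat).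
Context (astar : policy G -> forecast G -> action G) (L : learner G).
Context (pstar : forecast G -> benchmark G).
Context (d : measure_display) (Omega : measurableType d).
Context (F : forecaster G Omega) (y : T.-tuple (state G)).

Lemma measurable_bias_excess (Es Es' : {fset event G}) (C : R) E :
  measurable_forecaster F Es -> E \in Es ->
  measurable_fun [set: Omega]
    (fun w => bias (forecasts F y w) y E - bias_rate C Es' (forecasts F y w) E).
Proof.
move=> mF EEs.
have mE (t : 'I_T) : measurable_fun [set: Omega]
    (fun w => (E (tnth (forecasts F y w) t))%:R : R).
  rewrite [X in measurable_fun _ X](_ : _ = fun w => if E (F w (take t y)) then 1 else 0 : R).
    apply: measurable_fun_ifT => //; apply: (measurable_fun_bool true).
    by rewrite setTI; exact: (mF (take t y)).2.
  by apply/funext => w; rewrite tnth_mktuple; case: (E _).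
have mf (t : 'I_T) j : measurable_fun [set: Omega] (fun w => tnth (forecasts F y w) t j).
  rewrite [X in measurable_fun _ X](_ : _ = fun w => F w (take t y) j).
    exact: (mF (take t y)).1.
  by apply/funext => w; rewrite tnth_mktuple.
apply: measurable_funB.
  apply: measurable_funM => //; apply: measurable_sum => j.
  apply: measurableT_comp => //; apply: measurable_sum => t.
  by apply: measurable_funM => //; apply: measurable_funB.
apply: measurable_funM => //; apply: measurable_funD => //.
apply: measurable_funM => //; apply: measurable_funM => //.
apply: (measurableT_comp (continuous_measurable_fun (@sqrt_continuous R))).
apply: measurable_funM => //.
rewrite [X in measurable_fun _ X](_ : _ =
  fun w => \sum_(t < T) (E (tnth (forecasts F y w) t))%:R : R); first exact: measurable_sum.
apply/funext => w; rewrite /occurrences -sum1_card natr_sum big_mkcond /=.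
by apply: eq_bigr => t _; rewrite inE; case: (E _).
Qed.

Lemma response_eventP p a :
  response_event astar p a \in response_events astar `|` choice_events astar pstar.
Proof.
by rewrite in_fsetU; apply/orP; left; apply/imfsetP; exists (p, a) => //=; rewrite inE.
Qed.

Lemma choice_eventP pa :
  choice_event astar pstar pa \in response_events astar `|` choice_events astar pstar.
Proof.
by rewrite in_fsetU; apply/orP; right; apply/imfsetP; exists pa => //=; rewrite inE.
Qed.

Lemma card_events_le :
  (#|` response_events astar `|` choice_events astar pstar| <=
   2 * (#|` benchmark G| * #|{: action G}|))%N.
Proof.
have -> : (#|` benchmark G| * #|{: action G}|)%N = #|[set: benchmark G * action G]%SET|.
  by rewrite cardsT card_prod cardfE.
rewrite mul2n -addnn cardfsU (leq_trans (leq_subr _ _)) // leq_add //.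
  by rewrite (leq_trans (leq_imfset_card _ _ _)) // cardE.
by rewrite (leq_trans (leq_imfset_card _ _ _)) // cardE.
Qed.

Lemma measurable_policy_regret :
  measurable_forecaster F (response_events astar `|` choice_events astar pstar) ->
  measurable_fun [set: Omega]
    (fun w => policy_regret astar L (forecasts F y w) y (val \o pstar)).
Proof.
move=> mF.
(* The regret depends on the seed only through finitely many values. *)
pose code (x : forecast G) := (pstar x, [ffun p : benchmark G => astar (val p) x]).
apply: (@measurable_fun_finite_factor _ _ _ _ (fun w => map_tuple code (forecasts F y w))).
  (* A fibre of the code prescribes in each round one choice event and one response event per
     benchmark policy, all measurable by assumption. *)
  move=> c; rewrite [X in measurable X](_ : _ = (\bigcap_(t in [set: 'I_T])
    ([set w | choice_event astar pstar
        ((tnth c t).1, (tnth c t).2 (tnth c t).1) (F w (take t y))] `&`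
     \bigcap_(p in [set: benchmark G])
       [set w | response_event astar p ((tnth c t).2 p) (F w (take t y))]))%classic).
    apply: fin_bigcap_measurable => // t _; apply: measurableI.
      by apply: (mF (take t y)).2; exact: choice_eventP.
    apply: fin_bigcap_measurable => // p _.
    by apply: (mF (take t y)).2; exact: response_eventP.
  apply/seteqP; split=> w /=.
    move=> <- t _; rewrite tnth_map tnth_mktuple /=; split.
      by rewrite /choice_event /= ffunE !eqxx.
    by move=> p _; rewrite /response_event /= ffunE eqxx.
  move=> cw; apply: eq_from_tnth => t; rewrite tnth_map tnth_mktuple.
  have [/andP[/= /eqP p_eq _] a_eq] := cw t I.
  rewrite /code p_eq [RHS]surjective_pairing; congr pair.
  by apply/ffunP => p; rewrite ffunE; apply/eqP; exact: a_eq.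
move=> w w' eq_code; have codeE t : code (tnth (forecasts F y w) t) =
    code (tnth (forecasts F y w') t) by have := congr1 ((@tnth _ _)^~ t) eq_code; rewrite !tnth_map.
apply: policy_regret_ext => t; first by have [] := codeE t.
by move=> p; have [_ /ffunP/(_ p)] := codeE t; rewrite !ffunE.
Qed.

End ForecastMeasurability.

(** * The expected regret *)

(** Since [x <= 1], [x] is at most its root; since [l <= b <= b ^+ 2], the root of [l] is at most
    [b]. *)
Lemma rate_arith (R : realType) (l b x : R) :
  0 <= l -> l <= b -> 1 <= b -> 0 <= x <= 1 ->
  l * x + Num.sqrt l * Num.sqrt x <= 2 * b * Num.sqrt x.
Proof.
move=> l_ge0 l_le b_ge1 /andP[x_ge0 x_le1].
have x_sqr : x = Num.sqrt x * Num.sqrt x by rewrite -expr2 sqr_sqrtr.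
have sx_le1 : Num.sqrt x <= 1 by rewrite -sqrtr1 ler_wsqrtr.
have sx_ge0 := sqrtr_ge0 x.
have sl_le : Num.sqrt l <= b.
  rewrite -[b]ger0_norm -?sqrtr_sqr ?(le_trans ler01) // ler_wsqrtr //.
  by apply: le_trans l_le _; rewrite expr2 ler_peMl // (le_trans ler01).
have b_ge0 : 0 <= b := le_trans ler01 b_ge1.
have -> : 2 * b * Num.sqrt x = b * Num.sqrt x + b * Num.sqrt x by ring.
apply: lerD; last exact: ler_wpM2r.
apply: ler_pM => //; rewrite {1}x_sqr.
exact: ler_piMl.
Qed.

Lemma ln_events_le (R : realType) (P A Y N T : nat) :
  (N <= 2 * (P * A))%N ->
  ln (Y * N * T)%:R <= 1 + ln (T * Y * P * A)%:R :> R.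
Proof.
(* A zero product is harmless because [ln 0 = 0]; otherwise the factor 2 costs [ln 2 <= 1]. *)
move=> N_le; have [->|YNT_gt0] := posnP (Y * N * T).
  by rewrite ln0 // addr_ge0 // ln_nat_ge0.
have le_prod : (Y * N * T <= 2 * (T * Y * P * A))%N.
  apply: leq_trans (_ : Y * (2 * (P * A)) * T <= _)%N.
    by rewrite leq_mul2r leq_mul2l N_le !orbT.
  by rewrite leq_eqVlt; apply/orP; left; apply/eqP; ring.
have prod_gt0 : (0 < T * Y * P * A)%N.
  by have := leq_trans YNT_gt0 le_prod; rewrite muln_gt0 => /andP[].
apply: le_trans (_ : ln (2 * (T * Y * P * A)%:R) <= _).
  rewrite ler_ln ?posrE ?mulr_gt0 ?ltr0n //.
  by rewrite -natrM ler_nat.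
rewrite lnM ?posrE ?ltr0n // lerD2r.
by apply: (@le_ln1Dx R 1); lra.
Qed.

Theorem theorem5 (R : realType) (C0 : R) (hC0 : 0 < C0) :
  exists (C : R) (k : nat),
  forall (G : principal_agent R)
    (astar : policy G -> forecast G -> action G)
    (pstar : forecast G -> benchmark G)
    (L : learner G)
    (T : nat)
    (d : measure_display) (Omega : measurableType d)
    (mu : probability Omega R)
    (F : forecaster G Omega)
    (y : T.-tuple (state G))
    (eps_swap eps_neg M1 M2 : R),
  (0 < T)%N ->
  is_response astar ->
  is_policy_choice astar pstar ->
  unbiased_forecaster mu T C0 F
    (response_events astar `|` choice_events astar pstar) ->
  0 <= M1 ->
  {ae mu, forall w,
     no_contextual_swap_regret astar L (forecasts F y w) y eps_swap pstar} ->
  {ae mu, forall w,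
     alignment astar L (forecasts F y w) y M1 M2 pstar} ->
  {ae mu, forall w,
     no_negative_cross_swap_regret astar L (forecasts F y w) y eps_neg pstar} ->
  (mechanism_regret mu astar F (val \o pstar) L y
   <= (C * (1 + ln (T * #|{: state G}| * #|` benchmark G|
                      * #|{: action G}|)%:R) ^+ k
         * (#|{: state G}|%:R
              * Num.sqrt ((#|` benchmark G| * #|{: action G}|)%:R / T%:R))
       + 2 * (M1 * (eps_swap + eps_neg) + M2))%:E)%E.
Proof.
(* Each of the two bias sums costs [2 * C0]. For few rounds, regret at most 2 and twice a slack of
   at least -2 call for 6. *)
exists (4 * C0 + 6), 1%N => G astar pstar L T d Omega mu F y eps_swap eps_neg M1 M2.
move=> T_gt0 _ pstarP [mF biasF] M1_ge0 swapP alignP negP.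
have C0_ge0 := ltW hC0.
set Es := response_events astar `|` choice_events astar pstar in mF biasF *.
set Y := #|{: state G}|; set P := #|` benchmark G|; set A := #|{: action G}|.
set b := 1 + ln (T * Y * P * A)%:R; set x := (P * A)%:R / T%:R.
have b_ge1 : 1 <= b by rewrite lerDl ln_nat_ge0.
have x_ge0 : 0 <= x by rewrite divr_ge0.
pose S w := sup [set bias (forecasts F y w) y E - bias_rate C0 Es (forecasts F y w) E
  | E in [set` Es]].
pose X w := policy_regret astar L (forecasts F y w) y (val \o pstar).
pose B := Y%:R + C0 * (Y%:R * ln (Y * #|` Es| * T)%:R / T%:R +
  Y%:R * Num.sqrt (ln (Y * #|` Es| * T)%:R * T%:R) / T%:R).
have S_le w : `|S w| <= B.
  have E_le E : `|bias (forecasts F y w) y E - bias_rate C0 Es (forecasts F y w) E| <= B.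
    apply: le_trans (ler_normB _ _) _.
    by apply: lerD; [exact: normr_bias_le | exact: normr_bias_rate_le].
  apply: normr_sup_fset_le => //.
  (* Any event yields [0 <= B]. *)
  by apply: le_trans (E_le (fun=> true)).
have mS : measurable_fun [set: Omega] S.
  by apply: measurable_fun_sup_fset => E EEs; exact: measurable_bias_excess mF EEs.
have mX : measurable_fun [set: Omega] X by exact: measurable_policy_regret.
(* One copy of [S] arises per response event of [p0] and per choice event. As [S] can have either
   sign, its coefficient is kept exact and independent of the seed. *)
pose c : R := if (P * A <= T)%N then (A + P * A)%:R else 0.
apply: (@expectation_le_affine _ _ _ mu X S c _ (Num.max B 2)) => //.
- by move=> w; rewrite le_max normr_policy_regret_le2 ?orbT.
- by move=> w; rewrite le_max S_le.
- by rewrite /c; case: ifP.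
- exact: biasF.
apply: filterS3 swapP alignP negP => w swapP alignP negP.
have slack_ge2 := slack_ge T_gt0 M1_ge0 swapP alignP negP.
have Y_ge1 : 1 <= Y%:R :> R.
  by rewrite ler1n; apply/card_gt0P; exists (tnth y (Ordinal T_gt0)).
have bY_ge0 : 0 <= b * (Y%:R * Num.sqrt x).
  by rewrite !mulr_ge0 ?sqrtr_ge0 // (le_trans ler01).
rewrite expr1 -(mulrA (4 * C0 + 6)) /c; case: leqP => [PA_le_T|T_lt_PA]; last first.
  have X_le2 : X w <= 2.
    by have := normr_policy_regret_le2 astar L pstar (forecasts F y w) y T_gt0 (val \o pstar);
      rewrite ler_norml => /andP[].
  have sx_ge1 : 1 <= Num.sqrt x.
    by rewrite -sqrtr1 ler_wsqrtr // ler_pdivlMr ?ltr0n // mul1r ler_nat ltnW.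
  have : 1 <= b * (Y%:R * Num.sqrt x).
    by apply: mulr_ege1 => //; apply: mulr_ege1.
  move: (b * _) bY_ge0 X_le2 slack_ge2 => z z_ge0.
  have : 0 <= C0 * z by rewrite mulr_ge0.
  by lra.
have biasP E : E \in Es -> bias (forecasts F y w) y E -
    bias_rate C0 Es (forecasts F y w) E <= S w by exact: ub_le_sup_fset.
have P_gt0 : (0 < P)%N.
  by rewrite /P cardfE; apply/card_gt0P; exists (pstar (tnth (forecasts F y w) (Ordinal T_gt0))).
have l_le : ln (Y * #|` Es| * T)%:R <= b by exact/ln_events_le/card_events_le.
(* One estimate for both families: [A] response events of a fixed policy, where [A <= P * A] needs
   [P_gt0], and [P * A] choice events. *)
have rate_le (I : finType) (k : forecast G -> I) (E : I -> event G) :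
    (forall i z, E i z = (k z == i)) -> (#|I| <= P * A)%N ->
    (forall i, E i \in Es) ->
    \sum_i bias (forecasts F y w) y (E i) <=
    #|I|%:R * S w + 2 * C0 * (b * (Y%:R * Num.sqrt x)).
  move=> Ek I_le EEs; apply: le_trans (sum_bias_le (fun i => biasP _ (EEs i))) _.
  rewrite lerD2l; apply: le_trans
    (@sum_bias_rate_le _ _ _ (forecasts F y w) _ _ _ Ek _ Es C0_ge0 (ln_nat_ge0 _ _)) _.
  have Ix : #|I|%:R / T%:R <= x by rewrite ler_wpM2r ?invr_ge0 // ler_nat.
  have x_le1 : x <= 1 by rewrite ler_pdivrMr ?ltr0n // mul1r ler_nat.
  apply: (@le_trans _ _ (C0 * Y%:R * (2 * b * Num.sqrt x))); last first.
    by rewrite le_eqVlt; apply/orP; left; apply/eqP; ring.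
  rewrite ler_wpM2l ?mulr_ge0 //.
  apply: le_trans (rate_arith (ln_nat_ge0 _ _) l_le b_ge1 _) _.
    by rewrite divr_ge0 // (le_trans Ix).
  by rewrite ler_wpM2l ?ler_wsqrtr // mulr_ge0 // (le_trans ler01).
have := policy_regret_le_bias T_gt0 M1_ge0 swapP alignP negP pstarP
  (fun p0 => rate_le _ (astar (val p0)) (response_event astar p0) (fun _ _ => erefl)
     (leq_pmull _ P_gt0) (fun a => response_eventP astar pstar p0 a))
  (rate_le _ (fun z => (pstar z, astar (val (pstar z)) z)) (choice_event astar pstar)
     (choice_eventE astar pstar) _ (choice_eventP astar pstar)).
rewrite card_prod -cardfE -/P -/A leqnn => /(_ isT) /le_trans; apply.
rewrite -/A natrD; move: (b * _) bY_ge0 => z z_ge0.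
by lra.
Qed.
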